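(* Suppose that the stratified Lie algebra $\mathfrak g$ is ultra-rigid, i.e., $\mathfrak p=\mathfrak g\rtimes\mathbb R$ is its full Tanaka prolongation. Then the set of all non-isomorphic modifications of $\mathfrak g$ is parametrised by $\mathfrak g_{-1}^*/\mathbb R_{>0}$. Moreover, all modifications of $\mathfrak g$ in $\mathfrak p$ are solvable, and the only nilpotent one is $\mathfrak g$ itself.
   Context: A stratified Lie algebra is a finite-dimensional real Lie algebra $\mathfrak g=\bigoplus_{i=-s}^{-1}\mathfrak g_i$ with $[\mathfrak g_{-1},\mathfrak g_j]=\mathfrak g_{j-1}$ for $-s+1\le j\le -1$ (and $[\mathfrak g_i,\mathfrak g_j]\subset\mathfrak g_{i+j}$, with $\mathfrak g_k=0$ for $k<-s$). Let $D:\mathfrak g\to\mathfrak g$ be the derivation with $Dv=jv$ for $v\in\mathfrak g_{-j}$. The dilations of $\mathfrak g$ are the maps $\delta_\lambda$, $\lambda>0$, given by $\delta_{e^t}=e^{tD}$, i.e. $\delta_\lambda v=\lambda^jv$ for $v\in\mathfrak g_{-j}$. $\mathfrak g$ is called ultra-rigid if the only Lie algebra automorphisms of $\mathfrak g$ preserving the stratification are dilations. The semi-direct product $\mathfrak p=\mathfrak g\rtimes\mathbb R$ is the vector space $\mathfrak g\times\mathbb R$ with bracket $[(X,a),(Y,b)]=([X,Y]+aDY-bDX,0)$. Here $\mathfrak q=\{0\}\times\mathbb R$, and $\mathfrak g$ is identified with $\mathfrak g\times\{0\}$. The full Tanaka prolongation of $\mathfrak g$ is the maximal graded Lie algebra $\bigoplus_{k\ge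 -s}\mathfrak g_k$ with non-positive part $\mathfrak g\oplus\mathfrak g_0$, where $\mathfrak g_0$ is the algebra of all derivations of $\mathfrak g$ preserving $\mathfrak g_{-1}$, such that $u\in\mathfrak g_k$, $k\ge0$, $[u,\mathfrak g_{-1}]=0$ imply $u=0$. That it equals $\mathfrak g\rtimes\mathbb R$ means that $\mathfrak g_0=\mathbb R D$ and $\mathfrak g_k=0$ for all $k\ge1$. A modification of $\mathfrak g$ in $\mathfrak p$ is a pair $(\mathfrak s,\mathfrak s_{-1})$ where $\mathfrak s\subset\mathfrak p$ is a Lie subalgebra with $\mathfrak p=\mathfrak s\oplus\mathfrak q$ (as vector spaces) and $\mathfrak s_{-1}=(\mathfrak g_{-1}\times\mathbb R)\cap\mathfrak s$. A modification of $\mathfrak g$ is a pair (Lie algebra, bracket-generating subspace) isomorphic to a modification of $\mathfrak g$ in $\mathfrak p$, where an isomorphism of such pairs $(\mathfrak s,\mathfrak s_{-1})$, $(\mathfrak s',\mathfrak s'_{-1})$ is a Lie algebra isomorphism $\phi:\mathfrak s\to\mathfrak s'$ with $\phi(\mathfrak s_{-1})=\mathfrak s'_{-1}$. The parametrisation is as follows: $\sigma\in\mathfrak g_{-1}^*$ corresponds to the modification $\mathfrak s_\sigma=\{(X,\sigma(X_{-1})):X\in\mathfrak g\}$ in $\mathfrak p$, where $X_{-1}$ is the $\mathfrak g_{-1}$-component of $X$; every modification of $\mathfrak g$ in $\mathfrak p$ is of this form; and $\mathfrak s_\sigma$, $\mathfrak s_\tau$ are isomorphic if and only if $\sigma=\lambda\tau$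 for some $\lambda>0$.
   Formalization: As v ↦ (-1)^j v on g_{-j} is always an automorphism and makes s_σ, s_{-σ} isomorphic, the classification is proved with nonzero dilation factors (quotient by nonzero reals, not R_{>0}), assuming both the automorphism and the Tanaka condition; the literal λ>0 clause is vacuous. *)

(* Defs.v *)
(* MathComp; the real numbers are an arbitrary [R : realType]. *)
From HB Require Import structures.
From mathcomp Require Import all_boot all_order all_algebra.
From mathcomp Require Import reals.
Set Implicit Arguments.
Unset Strict Implicit.
Unset Printing Implicit Defensive.
Import Order.TTheory GRing.Theory Num.Theory.
Local Open Scope ring_scope.

Definition is_lie (R : realType) (L : lmodType R) (br : L -> L -> L) : Prop :=
  [/\ forall a x y z, br (a *: x + y) z = a *: br x z + br y z,
      forall a x y z, br x (a *: y + z) = a *: br x y + br x z,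
      forall x, br x x = 0
    & forall x y z, br x (br y z) + br y (br z x) + br z (br x y) = 0].

Section FiniteDimensional.
Variables (R : realType) (L : vectType R) (br : L -> L -> L).
Implicit Types U V W : {vspace L}.

(* For bilinear [br] this is the span of all [br x y], x \in U, y \in W. *)
Definition br_span U W : {vspace L} :=
  <<[seq br x y | x <- vbasis U, y <- vbasis W]>>%VS.

Definition subalgebra U : Prop :=
  forall x y, x \in U -> y \in U -> br x y \in U.

Definition solvable_alg U : Prop :=
  exists n, iter n (fun W => br_span W W) U = 0%VS.

Definition nilpotent_alg U : Prop :=
  exists n, iter n (br_span U) U = 0%VS.

(* V generates the Lie algebra U. *)
Definition bracket_generating U V : Prop :=
  (V <= U)%VS /\ forall W, subalgebra W -> (V <= W)%VS -> (U <= W)%VS.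

End FiniteDimensional.

(* A Lie algebra together with a subspace, presented inside an ambient Lie
   algebra: [lp_alg] is the Lie algebra and [lp_hor] the subspace.  An abstract
   Lie algebra is the case [lp_alg = fullv]. *)
Record lie_pair (R : realType) := LiePair {
  lp_space : vectType R;
  lp_br : lp_space -> lp_space -> lp_space;
  lp_alg : {vspace lp_space};
  lp_hor : {vspace lp_space} }.

Definition is_lie_pair (R : realType) (P : lie_pair R) : Prop :=
  [/\ is_lie (@lp_br R P), subalgebra (@lp_br R P) (lp_alg P)
    & bracket_generating (@lp_br R P) (lp_alg P) (lp_hor P)].

(* The linear map [lp_alg P -> lp_alg Q] is given by an extension to the ambient
   space of P; only its values on [lp_alg P] matter. *)
Definition pair_iso (R : realType) (P Q : lie_pair R) : Prop :=
  exists f : 'Hom(lp_space P, lp_space Q),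
    [/\ (f @: lp_alg P = lp_alg Q)%VS,
        {in lp_alg P &, injective f},
        {in lp_alg P &, forall x y, f (lp_br x y) = lp_br (f x) (f y)}
      & (f @: lp_hor P = lp_hor Q)%VS].

(* [layer j] is g_{-j}; it is zero unless 1 <= j <= step. *)
Record stratLie (R : realType) := StratLie {
  carrier :> vectType R;
  bracket : carrier -> carrier -> carrier;
  step : nat;
  layer : nat -> {vspace carrier};
  bracket_lie : is_lie bracket;
  step_gt0 : (0 < step)%N;
  layer_out : forall j, ~~ (1 <= j <= step)%N -> layer j = 0%VS;
  layer_direct : directv (\sum_(j < step.+1) layer j)%VS;
  layer_full : (\sum_(j < step.+1) layer j)%VS = fullv;
  layer_bracket : forall i j x y,
    x \in layer i -> y \in layer j -> bracket x y \in layer (i + j)%N;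
  layer_generated : forall j, (1 <= j < step)%N ->
    br_span bracket (layer 1) (layer j) = layer j.+1 }.

Section Stratified.
Variables (R : realType) (g : stratLie R).

Definition layer_proj (j : nat) : 'End(g) :=
  daddv_pi (layer g j) (\sum_(i < (step g).+1 | i != j :> nat) layer g i)%VS.

Definition degD : 'End(g) := \sum_(j < (step g).+1) j%:R *: layer_proj j.

Definition dilation (l : R) : 'End(g) :=
  \sum_(j < (step g).+1) (l ^+ j) *: layer_proj j.

Definition graded_automorphism (phi : 'End(g)) : Prop :=
  [/\ bijective phi,
      forall x y, phi (bracket x y) = bracket (phi x) (phi y)
    & forall j, (phi @: layer g j = layer g j)%VS].

(* [ratio] is the set of admissible dilation factors.  It is a parameter
   because dilation (-1), i.e. v |-> (-1)^j v on g_{-j}, is always a graded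
   automorphism: with positive factors only, the property fails as soon as
   g is nonzero. *)
Definition ultra_rigid (ratio : R -> Prop) : Prop :=
  forall phi, graded_automorphism phi -> exists2 l, ratio l & phi = dilation l.

(* g x| R, with bracket [(X, a), (Y, b)] = ([X, Y] + a DY - b DX, 0). *)
Definition semidirect : vectType R := (g * R^o)%type.

Definition semidirect_br (u v : semidirect) : semidirect :=
  (bracket u.1 v.1 + (u.2 : R) *: degD v.1 - (v.2 : R) *: degD u.1, 0).

Definition p_fst : 'Hom(semidirect, g) := linfun (fun u : semidirect => u.1).
Definition p_snd : 'Hom(semidirect, R^o) := linfun (fun u : semidirect => u.2).

(* {0} x R *)
Definition q_line : {vspace semidirect} := lker p_fst.
(* g x {0} *)
Definition g_in_p : {vspace semidirect} := lker p_snd.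

(* (g_{-1} x R) :&: s *)
Definition horizontal (s : {vspace semidirect}) : {vspace semidirect} :=
  ((p_fst @^-1: layer g 1) :&: s)%VS.

Definition modification_in_p (s : {vspace semidirect}) : Prop :=
  [/\ subalgebra semidirect_br s, (s + q_line = fullv)%VS
    & (s :&: q_line = 0)%VS].

Definition pair_in_p (s : {vspace semidirect}) : lie_pair R :=
  LiePair semidirect_br s (horizontal s).

Definition is_modification (P : lie_pair R) : Prop :=
  is_lie_pair P /\ exists2 s, modification_in_p s & pair_iso P (pair_in_p s).

Definition dual1 : vectType R := 'Hom(subvs_of (layer g 1), R^o).

(* {(X, sigma X_{-1}) : X \in g} *)
Definition s_ (sigma : dual1) : {vspace semidirect} :=
  limg (linfun (fun x : g =>
    (x, sigma (vsproj (layer g 1) (layer_proj 1 x))) : semidirect)).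

(* sigma |-> s_ sigma is a bijection onto the modifications in p, and induces
   a bijection from the classes of g_{-1}^* under [ratio] onto the isomorphism
   classes of modifications of g. *)
Definition parametrised_by_dual1_mod (ratio : R -> Prop) : Prop :=
  [/\ forall s, modification_in_p s <-> exists! sigma, s = s_ sigma,
      forall sigma, is_modification (pair_in_p (s_ sigma)),
      forall P, is_modification P -> exists sigma, pair_iso P (pair_in_p (s_ sigma))
    & forall sigma tau, pair_iso (pair_in_p (s_ sigma)) (pair_in_p (s_ tau)) <->
        exists2 l, ratio l & sigma = l *: tau].

(* g_0 of the Tanaka prolongation *)
Definition derivation0 (d : 'End(g)) : Prop :=
  (forall x y, d (bracket x y) = bracket (d x) y + bracket x (d y)) /\
  (d @: layer g 1 <= layer g 1)%VS.

End Stratified.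

(* Z-graded Lie algebras of possibly infinite dimension; [part k] is the set of
   homogeneous elements of degree k. *)
Record gradedLie (R : realType) := GradedLie {
  gl_space :> lmodType R;
  gl_br : gl_space -> gl_space -> gl_space;
  part : int -> gl_space -> Prop }.

Definition is_graded_lie (R : realType) (H : gradedLie R) : Prop :=
  [/\ is_lie (@gl_br R H),
      forall k, part k (0 : H) /\
        forall (a : R) (x y : H), part k x -> part k y -> part k (a *: x + y),
      forall i j (x y : H), part i x -> part j y -> part (i + j) (gl_br x y),
      forall x : H, exists (r : seq int) (y : int -> H),
        (forall k, part k (y k)) /\ x = \sum_(k <- r) y k
    & forall (r : seq int) (y : int -> H), uniq r -> (forall k, part k (y k)) ->
        \sum_(k <- r) y k = 0 -> forall k, k \in r -> y k = 0].

(* H has non-positive part g (+) g_0, where [iota] identifies g with the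
   negative part and u in degree 0 is identified with the derivation [u, _]
   of g; no element of non-negative degree centralises g_{-1}. *)
Definition is_prolongation (R : realType) (g : stratLie R) (H : gradedLie R)
    (iota : {linear g -> H}) : Prop :=
  is_graded_lie H /\
  [/\ injective iota /\
        forall x y, iota (bracket x y) = gl_br (iota x) (iota y),
      forall (j : nat) (u : H), (0 < j)%N ->
        part (- (j%:Z)) u <-> exists2 x, x \in layer g j & u = iota x,
      forall u : H, part 0 u ->
        exists2 d, derivation0 d & forall x, gl_br u (iota x) = iota (d x),
      forall d : 'End(g), derivation0 d ->
        exists2 u : H, part 0 u & forall x, gl_br u (iota x) = iota (d x)
    & forall (k : nat) (u : H), part k%:Z u ->
        (forall x, x \in layer g 1 -> gl_br u (iota x) = 0) -> u = 0].

(* H is the maximal prolongation: every other one embeds in it over g. *)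
Definition is_full_tanaka_prolongation (R : realType) (g : stratLie R)
    (H : gradedLie R) (iota : {linear g -> H}) : Prop :=
  is_prolongation iota /\
  forall (H' : gradedLie R) (iota' : {linear g -> H'}), is_prolongation iota' ->
    exists f : {linear H' -> H},
      [/\ injective f,
          forall x y, f (gl_br x y) = gl_br (f x) (f y),
          forall k x, part k x -> part k (f x)
        & forall x, f (iota' x) = iota x].

Section GradedSemidirect.
Variables (R : realType) (g : stratLie R).

Definition p_part (k : int) (u : semidirect g) : Prop :=
  match k with
  | Posz 0 => u.1 = 0
  | Posz _.+1 => u = 0
  | Negz j => u.1 \in layer g j.+1 /\ u.2 = 0
  end.

Definition p_graded : gradedLie R := GradedLie (@semidirect_br R g) p_part.

Definition g_to_p (x : g) : p_graded := ((x, 0) : semidirect g).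

Fact g_to_p_is_linear : linear g_to_p.
Proof. by move=> a x y; congr pair; rewrite /= addr0 [RHS]mulr0. Qed.

HB.instance Definition _ :=
  GRing.isLinear.Build R g p_graded *:%R g_to_p g_to_p_is_linear.

End GradedSemidirect.

(* g x| R, graded by g_{-j} in degree -j and {0} x R in degree 0, is the full
   Tanaka prolongation of g. *)
Definition full_tanaka_is_semidirect (R : realType) (g : stratLie R) : Prop :=
  is_full_tanaka_prolongation (@g_to_p R g : {linear g -> p_graded g}).

(* Main.v *)
(* A modification in p is a complement of q, hence the graph of a linear form on
   g; closure under the bracket forces the form to vanish on g_{-j} for j >= 2.
   An isomorphism between s_ sigma and s_ tau is an automorphism of g, for two
   brackets twisted by sigma and tau, that preserves the filtration generated by
   g_{-1}.  Its associated graded map is an automorphism of g, hence a dilation by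
   ultra-rigidity, and after composition with the inverse dilation sigma becomes
   comparable with l tau.  The component of degree 1 of the resulting unipotent map,
   together with the form l tau - sigma, would be an element of degree 1 in the
   Tanaka prolongation; as that prolongation is g x| R, the form is zero.  The same
   vanishing excludes g = R, the only case in which a nonzero sigma could give a
   nilpotent modification. *)
From HB Require Import structures.
Require Import Defs.
From mathcomp Require Import all_boot all_order all_algebra.
From mathcomp Require Import reals ring zify.
Set Implicit Arguments.
Unset Strict Implicit.
Unset Printing Implicit Defensive.
Import Order.TTheory GRing.Theory Num.Theory.
Local Open Scope ring_scope.

(** * Linear algebra: testing identities against linear forms *)

Lemma scalar_ext (R : realType) (L : vectType R) (x y : L) :
  (forall phi : {scalar L}, phi x = phi y) -> x = y.
Proof.
move=> e; rewrite (coord_vbasis (memvf x)) (coord_vbasis (memvf y)).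
by apply: eq_bigr => i _; congr (_ *: _); apply: (e (coord (vbasis fullv) i)).
Qed.

Lemma scale_regularE (R : realType) (a : R) (r : R^o) : a *: r = a * (r : R).
Proof. by []. Qed.

Lemma linfun_linear (R : realType) (U V : vectType R) (f : U -> V) :
  linear f -> linfun f =1 f.
Proof.
move=> f_lin.
pose F : {linear U -> V} := HB.pack f (GRing.isLinear.Build R U V *:%R f f_lin).
exact: (lfunE F).
Qed.

Lemma lfun_linE (R : realType) (U V : vectType R) (f : 'Hom(U, V)) :
  {morph f : x y / x + y} * {morph f : x / - x} * (f 0 = 0)
   * (forall a x, f (a *: x) = a *: f x).
Proof.
split; last by move=> a x; rewrite linearZ.
by split; [split; [exact: linearD | exact: linearN] | exact: linear0].
Qed.

Ltac linear_ring := rewrite ?(scale_regularE, lfun_linE); ring.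

(* Scalar-valued linear maps turn linear identities in a vector space into ring
   identities. *)
Ltac vect_ring :=
  let phi := fresh "phi" in apply: scalar_ext => phi;
  rewrite ?(linearD phi, linearN phi, scalarZ phi, linear0 phi, scale_regularE) /=; ring.

(** * Spans of brackets *)

Section BracketSpan.
Variables (R : realType) (L : vectType R) (br : L -> L -> L).
Implicit Types U V W : {vspace L}.

(** [br_span] only brackets basis vectors; expanding both arguments in the bases and using
    bilinearity reaches all the others. *)
Lemma memv_br_span U W x y :
  is_lie br -> x \in U -> y \in W -> br x y \in br_span br U W.
Proof.
case=> brl brr _ _ xU yW.
have fl : linear (br^~ y) by move=> a u v; apply: brl.
have fr v : linear (br v) by move=> a u w; apply: brr.
pose FL : {linear L -> L} := HB.pack (br^~ y) (GRing.isLinear.Build R L L *:%R _ fl).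
pose FR v : {linear L -> L} := HB.pack (br v) (GRing.isLinear.Build R L L *:%R _ (fr v)).
rewrite -[br x y]/(FL x) (coord_vbasis xU) linear_sum; apply: memv_suml => i _.
rewrite linearZ /= -[br _ y]/(FR _ y); apply: memvZ.
rewrite (coord_vbasis yW) linear_sum; apply: memv_suml => j _.
rewrite linearZ; apply/memvZ/memv_span/allpairsP.
by exists ((vbasis U)`_i, (vbasis W)`_j); rewrite !mem_nth ?size_tuple.
Qed.

Lemma br_span_subP U W V :
  {in U & W, forall x y, br x y \in V} -> (br_span br U W <= V)%VS.
Proof.
move=> brV; apply/span_subvP => _ /allpairsP[[x y] [/= xU yW ->]].
by apply: brV; apply: vbasis_mem.
Qed.

End BracketSpan.

(** * Layer projections and the degree derivation of a stratified algebra *)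

Section Graded.
Variables (R : realType) (g : stratLie R).
Implicit Types (x y z : g) (U V W : {vspace g}).

Local Notation "[ x , y ]" := (bracket x y).
Local Notation pi := (@layer_proj R g).

Fact bracket_is_linear x : linear (bracket x).
Proof. by case: (bracket_lie g) => _ + _ _ a u v; apply. Qed.
HB.instance Definition _ x :=
  GRing.isLinear.Build R g g *:%R (bracket x) (bracket_is_linear x).

Lemma bracketxx x : [x, x] = 0.
Proof. by case: (bracket_lie g). Qed.

Lemma bracketDl y : {morph (fun x => [x, y]) : x z / x + z}.
Proof.
by move=> x z; case: (bracket_lie g) => /(_ 1 x z y); rewrite !scale1r.
Qed.

Lemma bracketC x y : [x, y] = - [y, x].
Proof.
have := bracketxx (x + y); rewrite bracketDl !linearD /= !bracketxx.
by rewrite add0r addr0 => /eqP; rewrite addr_eq0 => /eqP.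
Qed.

Lemma bracket0l y : [0, y] = 0.
Proof. by rewrite bracketC linear0 oppr0. Qed.

Lemma bracketNl x y : [- x, y] = - [x, y].
Proof. by rewrite bracketC linearN /= -(bracketC x). Qed.

Lemma bracketZl a x y : [a *: x, y] = a *: [x, y].
Proof. by rewrite bracketC linearZ /= -scalerN -(bracketC x). Qed.

Lemma bracketDr x : {morph bracket x : y z / y + z}.
Proof. exact: linearD. Qed.

Lemma bracketNr x : {morph bracket x : y / - y}.
Proof. exact: linearN. Qed.

Lemma bracketZr a x y : [x, a *: y] = a *: [x, y].
Proof. exact: linearZ. Qed.

Definition bracket_linE := (bracketDl, bracketNl, bracketZl, bracketDr, bracketNr,
  bracketZr).

Lemma layer0 : layer g 0 = 0%VS.
Proof. exact: layer_out. Qed.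

Lemma layer_big j : (step g < j)%N -> layer g j = 0%VS.
Proof. by move=> h; apply: layer_out; rewrite negb_and -!ltnNge h orbT. Qed.

Let cap_layers j :
  (layer g j :&: \sum_(i < (step g).+1 | i != j :> nat) layer g i)%VS = 0%VS.
Proof.
case: (ltnP j (step g).+1) => [jn|]; last by move/layer_big ->; rewrite cap0v.
by have /directv_sumP/(_ (Ordinal jn) isT) := layer_direct g.
Qed.

Lemma layer_proj_mem j x : pi j x \in layer g j.
Proof. exact: memv_pi. Qed.

Lemma layer_proj_id j x : x \in layer g j -> pi j x = x.
Proof. by move=> xj; rewrite /layer_proj daddv_pi_id. Qed.

Lemma layer_proj_big j x : (step g < j)%N -> pi j x = 0.
Proof.
by move=> h; apply/eqP; rewrite -memv0 -(layer_big h) layer_proj_mem.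
Qed.

Lemma layer_proj_layer0 x : pi 0 x = 0.
Proof. by apply/eqP; rewrite -memv0 -layer0 layer_proj_mem. Qed.

Lemma layer_proj_other i j x : x \in layer g i -> i != j -> pi j x = 0.
Proof.
move=> xi ij.
have [h|h] := ltnP (step g) i.
  by move: xi; rewrite (layer_big h) memv0 => /eqP ->; rewrite linear0.
set V := (\sum_(i < (step g).+1 | i != j :> nat) layer g i)%VS.
have xV : x \in V.
  by apply: (subvP _) xi; apply: (sumv_sup (Ordinal (h : (i < (step g).+1)%N))).
have VU : (V :&: layer g j = 0)%VS by rewrite capvC cap_layers.
have xUV : x \in (layer g j + V)%VS by apply: (subvP (addvSr _ _)).
have := daddv_pi_add (cap_layers j) xUV.
by rewrite (daddv_pi_id VU xV) -[RHS]add0r => /addIr.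
Qed.

Lemma layer_projE i j x : x \in layer g i -> pi j x = if i == j then x else 0.
Proof.
by move=> xi; case: eqP => [<-|/eqP/(layer_proj_other xi)//]; apply: layer_proj_id.
Qed.

Lemma layer_decomp x : x = \sum_(j < (step g).+1) pi j x.
Proof.
have : x \in (\sum_(j < (step g).+1) layer g j)%VS by rewrite layer_full memvf.
case/memv_sumP => xs xsP ->; apply: eq_bigr => j _.
rewrite linear_sum (bigD1 j) //= layer_proj_id ?xsP // big1 ?addr0 // => i ij.
by apply: layer_proj_other (xsP i isT) _.
Qed.

(** Reduces additive statements to homogeneous elements. Only layers [j.+1] occur because layer 0 is
    zero. *)
Lemma layer_ind (P : g -> Prop) : P 0 -> (forall x y, P x -> P y -> P (x + y)) ->
  (forall j x, x \in layer g j.+1 -> P x) -> forall x, P x.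
Proof.
move=> P0 PD Pl x; rewrite (layer_decomp x); elim/big_ind: _ => // j _.
case: j => [[|j] jn] /=; first by rewrite layer_proj_layer0.
exact/Pl/layer_proj_mem.
Qed.

Lemma layer_proj_inj x y : (forall j, pi j x = pi j y) -> x = y.
Proof. by move=> e; rewrite (layer_decomp x) (layer_decomp y); apply: eq_bigr. Qed.

(** Evaluates on a homogeneous element any map defined degree by degree: [degD], [dilation] and
    later the associated graded map. *)
Lemma sum_layer_proj (F : nat -> g -> g) i x : (forall j, F j 0 = 0) ->
  x \in layer g i -> \sum_(j < (step g).+1) F j (pi j x) = F i x.
Proof.
move=> F0 xi; have [h|h] := ltnP (step g) i.
  move: xi; rewrite (layer_big h) memv0 => /eqP ->; rewrite F0 big1 // => j _.
  by rewrite linear0 F0.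
rewrite (bigD1 (Ordinal (h : (i < (step g).+1)%N))) //= layer_proj_id // big1 ?addr0 // => j ij.
by rewrite (layer_proj_other xi) ?F0 // eq_sym.
Qed.

Lemma degD_layer j x : x \in layer g j -> degD g x = j%:R *: x.
Proof.
move=> xj; rewrite /degD sum_lfunE.
under eq_bigr do rewrite scale_lfunE.
by rewrite (@sum_layer_proj ( fun j v => j%:R *: v) _ _ _ xj) // => k; rewrite scaler0.
Qed.

Lemma dilation_layer l j x : x \in layer g j -> dilation g l x = l ^+ j *: x.
Proof.
move=> xj; rewrite /dilation sum_lfunE.
under eq_bigr do rewrite scale_lfunE.
by rewrite (@sum_layer_proj ( fun j v => l ^+ j *: v) _ _ _ xj) // => k; rewrite scaler0.
Qed.

Lemma layer_proj_degD k x : pi k (degD g x) = k%:R *: pi k x.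
Proof.
elim/layer_ind: x => [|x y IHx IHy|j x xj]; first by rewrite !linear0.
  by rewrite !linearD /= IHx IHy.
rewrite (degD_layer xj) linearZ /= (layer_projE _ xj).
by case: eqP => [->//|_]; rewrite !scaler0.
Qed.

Lemma degD_bracket x y : degD g [x, y] = [degD g x, y] + [x, degD g y].
Proof.
elim/layer_ind: x => [|x x' IHx IHx'|i x xi]; first by rewrite !(linear0, bracket0l) addr0.
  by rewrite !(linearD, bracketDl) /= IHx IHx' addrACA.
elim/layer_ind: y => [|y y' IHy IHy'|j y yj]; first by rewrite !linear0 addr0.
  by rewrite !linearD /= IHy IHy' addrACA.
rewrite (degD_layer xi) (degD_layer yj) (degD_layer (layer_bracket xi yj)).
by rewrite natrD scalerDl bracketZl linearZ.
Qed.

Lemma layer_proj_bracketl k i x y : x \in layer g i ->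
  pi (i + k) [x, y] = [x, pi k y].
Proof.
move=> xi; elim/layer_ind: y => [|y y' IHy IHy'|j y yj]; first by rewrite !linear0.
  by rewrite !linearD /= IHy IHy'.
rewrite (layer_projE _ (layer_bracket xi yj)) (layer_projE _ yj) eqn_add2l.
by case: eqP => _ //; rewrite linear0.
Qed.

(** The Cauchy product formula for a graded bracket; every later degree count rests on it. *)
Lemma layer_proj_bracket m x y :
  pi m [x, y] = \sum_(k < m.+1) [pi k x, pi (m - k) y].
Proof.
elim/layer_ind: x => [|x x' IHx IHx'|i x xi].
- by rewrite !(linear0, bracket0l) big1 // => k _; rewrite linear0 bracket0l.
- rewrite !(linearD, bracketDl) /= IHx IHx' -big_split; apply: eq_bigr => k _.
  by rewrite linearD bracketDl.
have [im|mi] := leqP i.+1 m.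
  rewrite (bigD1 (inord i.+1)) //= inordK ?ltnS // (layer_proj_id xi) big1.
    by rewrite addr0 -(layer_proj_bracketl (m - i.+1) y xi) subnKC.
  move=> k ki; rewrite (layer_proj_other xi) ?bracket0l //.
  by apply: contraNneq ki => e; apply/eqP/val_inj; rewrite /= inordK ?ltnS.
rewrite big1 => [|k _]; last first.
  by rewrite (layer_proj_other xi) ?bracket0l //; apply/eqP => e; have := ltn_ord k; lia.
elim/layer_ind: y => [|y y' IHy IHy'|j y yj]; first by rewrite !linear0.
  by rewrite !linearD /= IHy IHy' addr0.
by rewrite (layer_proj_other (layer_bracket xi yj)) //; apply/eqP; lia.
Qed.

Lemma layer1_generates W : (layer g 1 <= W)%VS ->
  (forall x y, x \in layer g 1 -> y \in W -> [x, y] \in W) -> forall x, x \in W.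
Proof.
move=> gW Wbr; elim/layer_ind; [exact: mem0v | by move=> *; apply: memvD |].
suff h j : (layer g j.+1 <= W)%VS by move=> j x xj; apply: subvP (h j) _ xj.
elim: j => [//|j IH]; have [jn|jn] := ltnP j.+1 (step g).
  rewrite -(@layer_generated _ g j.+1) ?jn //; apply: br_span_subP => x y x1 yj.
  by apply: Wbr => //; apply: (subvP IH).
by rewrite layer_big ?sub0v // ltnS.
Qed.

End Graded.

(** * Adjoining an element of degree 1 to g x| R *)

Section DegreeOne.
Variables (R : realType) (g : stratLie R).
Variables (h : 'End(g)) (alpha : 'Hom(g, R^o)).
Hypothesis h_layer : forall j x, x \in layer g j.+1 -> h x \in layer g j.
Hypothesis alpha_layer : forall j x, x \in layer g j -> j != 1%N -> alpha x = 0.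
(** The Leibniz rule for [[u, _]], where [u] has degree 1 and [[u, X] = (h X, alpha X)]. The real
    component of [[u, X]] acts on the other argument through D, whence the two terms in [alpha]. *)
Hypothesis h_bracket : forall x y, h (bracket x y) = bracket (h x) y + bracket x (h y)
  + (alpha x : R) *: degD g y - (alpha y : R) *: degD g x.

Let c (x : g) : semidirect g := (h x, alpha x).

(* The extension of g x| R by one element u of degree 1 with
   [u, (X, a)] = (h X, alpha X) + a u. *)
Let ext : lmodType R := (semidirect g * R^o)%type.

Let ext_br (u v : ext) : ext :=
  (semidirect_br u.1 v.1 + (u.2 : R) *: c v.1.1 - (v.2 : R) *: c u.1.1,
   (u.2 : R) * v.1.2 - (v.2 : R) * u.1.2).

(** Since g x| R has nothing in degree 1, the degree 1 part here is exactly the line spanned by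
    [u]. *)
Let ext_graded : gradedLie R :=
  GradedLie ext_br (fun k u => Defs.p_part k u.1 /\ (k != 1 -> u.2 = 0)).

(** Together with [alpha_degD], this is the Jacobi identity for [u], the generator of q and [x]: the
    map [h] raises the degree by one. *)
Let degD_h x : h (degD g x) = degD g (h x) + h x.
Proof.
elim/layer_ind: x => [|x y IHx IHy|j x xj]; first by rewrite !linear0 addr0.
  by rewrite !linearD /= IHx IHy addrACA.
rewrite (degD_layer xj) (degD_layer (h_layer xj)) linearZ /=.
by rewrite -{3}[h x]scale1r -scalerDl natr1.
Qed.

Let alpha_degD x : alpha (degD g x) = alpha x.
Proof.
elim/layer_ind: x => [|x y IHx IHy|j x xj]; first by rewrite !linear0.
  by rewrite !linearD /= IHx IHy.
rewrite (degD_layer xj) linearZ /=; case: j xj => [|j] xj; first by rewrite scale1r.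
by rewrite (alpha_layer xj) // scaler0.
Qed.

Let alpha_bracket x y : alpha (bracket x y) = 0.
Proof.
elim/layer_ind: x => [|x x' IHx IHx'|i x xi]; first by rewrite bracket0l linear0.
  by rewrite bracketDl linearD /= IHx IHx' addr0.
elim/layer_ind: y => [|y y' IHy IHy'|j y yj]; first by rewrite !linear0.
  by rewrite !linearD /= IHy IHy' addr0.
by apply: alpha_layer (layer_bracket xi yj) _; rewrite addSn addnS.
Qed.

Lemma ext_lie : is_lie ext_br.
Proof.
split.
- move=> a [[X1 x1] r1] [[X2 x2] r2] [[X3 x3] r3].
  rewrite /ext_br /semidirect_br /c /=; congr (_, _, _) => /=.
  + rewrite ?(bracket_linE, lfun_linE); vect_ring.
  + linear_ring.
  + linear_ring.
- move=> a [[X1 x1] r1] [[X2 x2] r2] [[X3 x3] r3].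
  rewrite /ext_br /semidirect_br /c /=; congr (_, _, _) => /=.
  + rewrite ?(bracket_linE, lfun_linE); vect_ring.
  + linear_ring.
  + linear_ring.
- move=> [[X x] r]; rewrite /ext_br /semidirect_br /c /=; congr (_, _, _) => /=.
  + rewrite bracketxx; vect_ring.
  + linear_ring.
  + linear_ring.
(* Both derivation rules are rewritten with [h] and D in the second slot, the form in which they
   occur in nested brackets, so that [vect_ring] meets matching atoms. *)
have hE x y : h (bracket x y) = bracket x (h y) - bracket y (h x)
    + (alpha x : R) *: degD g y - (alpha y : R) *: degD g x.
  by rewrite h_bracket (bracketC (h x)) [- _ + _]addrC.
have DE x y : degD g (bracket x y) = bracket x (degD g y) - bracket y (degD g x).
  by rewrite degD_bracket (bracketC (degD g x)) addrC.
case=> [[X a] r] [[Y b] t] [[Z d] w].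
rewrite /ext_br /semidirect_br /c /=; congr (_, _, _) => /=.
- have J : bracket X (bracket Y Z) = - bracket Y (bracket Z X) - bracket Z (bracket X Y).
    by case: (bracket_lie g) => _ _ _ /(_ X Y Z); rewrite -addrA => /eqP;
       rewrite addr_eq0 opprD => /eqP.
  rewrite !(scale_regularE, bracket_linE, lfun_linE).
  rewrite ?(hE, DE, degD_h, alpha_degD) J.
  vect_ring.
- rewrite !lfun_linE !(alpha_degD, alpha_bracket); linear_ring.
- linear_ring.
Qed.

Let p_part0 k : Defs.p_part k (0 : semidirect g).
Proof. by case: k => [[|k]|k] //=; rewrite mem0v. Qed.

Let c_part i (x : g) a : Defs.p_part i ((x, a) : semidirect g) -> Defs.p_part (i + 1) (c x).
Proof.
have c0 : c 0 = 0 by rewrite /c !linear0.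
case: i => [[|i]|[|i]].
- by move=> /= ->; rewrite c0.
- by case=> -> _; rewrite c0; apply: p_part0.
- by case=> /h_layer; rewrite layer0 memv0 => /eqP.
case=> xi _; have -> : Negz i.+1 + 1 = Negz i by lia.
by split; [exact: h_layer xi | exact: alpha_layer xi _].
Qed.

Let p_part_snd i (u : semidirect g) : Defs.p_part i u -> i != 0 -> u.2 = 0.
Proof. by case: i => [[|i]|i] //= => [-> | []]. Qed.

Let sum1 I s (P : pred I) (F : I -> ext) :
  (\sum_(i <- s | P i) F i).1 = \sum_(i <- s | P i) (F i).1.
Proof. exact: (big_morph fst). Qed.

Let sum2 I s (P : pred I) (F : I -> ext) :
  (\sum_(i <- s | P i) F i).2 = \sum_(i <- s | P i) (F i).2.
Proof. exact: (big_morph snd). Qed.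

Lemma ext_graded_lie : is_graded_lie (p_graded g) -> is_graded_lie ext_graded.
Proof.
case=> _ pP pbr pdec pind; split.
- exact: ext_lie.
- move=> k; have [p0 pD] := pP k; split=> [|a x y [x1 x2] [y1 y2]]; first by [].
  split=> [|k1]; first exact: pD.
  by rewrite /= x2 // y2 // scaler0 addr0.
- move=> i j [[X a] r] [[Y b] t] [/= Xi ri] [/= Yj tj]; split=> /=.
    have pZ k s v : Defs.p_part k v -> Defs.p_part k ((s : R) *: v : semidirect g).
      by have [p0 pD] := pP k => pv; rewrite -[_ *: _]addr0; apply: pD.
    have pN k v w : Defs.p_part k v -> Defs.p_part k w ->
      Defs.p_part k (v + w : semidirect g).
      by have [p0 pD] := pP k => pv pw; rewrite -[v]scale1r; apply: pD.
    apply: (pN); first apply: (pN); first exact: (pbr i j (X, a) (Y, b)).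
      have [->|/ri ->] := eqVneq i 1; last by rewrite scale0r; case: (pP (i + j)).
      by apply: pZ; rewrite addrC; apply: c_part Yj.
    rewrite -scaleNr; have [->|/tj ->] := eqVneq j 1; last first.
      by rewrite oppr0 scale0r; case: (pP (i + j)).
    by apply: pZ; apply: c_part Xi.
  (* A nonzero [r] forces [i = 1]; then [j != 0] because [i + j != 1], and [b] vanishes outside
     degree 0. *)
  move=> ij1; have -> : r * b = 0.
    have [i1|/ri ->] := eqVneq i 1; last by rewrite mul0r.
    have -> : b = 0; last by rewrite mulr0.
    apply: p_part_snd Yj _; apply: contraNneq ij1 => ->; by rewrite i1.
  have -> : t * a = 0; last by rewrite subr0.
  have [j1|/tj ->] := eqVneq j 1; last by rewrite mul0r.
  have -> : a = 0; last by rewrite mulr0.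
  apply: p_part_snd Xi _; apply: contraNneq ij1 => ->; by rewrite j1.
- case=> p r; have [s [y [yP ->]]] := pdec p.
  (* As g x| R is zero in degree 1, index 1 is free to carry the multiple of [u]; it is first
     removed from [s] so that it is counted once. *)
  have y1 : y 1 = 0 by exact: (yP 1).
  exists (1 :: [seq k <- s | k != 1]), (fun k => if k == 1 then (0, r) else (y k, 0)).
  split=> [k|]; first by case: eqP => [->|/eqP k1]; split=> //; apply: yP.
  rewrite big_cons eqxx big_filter.
  rewrite (eq_bigr (fun k => (y k, 0))) => [|k /negPf -> //].
  rewrite (bigID (pred1 1)) /= big1 ?add0r => [|k /eqP -> //].
  rewrite [RHS]surjective_pairing /= sum1 sum2 /= big1_eq add0r addr0 //.
- move=> s y us yP ys0; have ys1 : \sum_(k <- s) (y k).1 = 0 by rewrite -sum1 ys0.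
  have := congr1 snd ys0; rewrite /= sum2 => ys2 k ks.
  have yk1 : (y k).1 = 0 by apply: (pind s (fun k => (y k).1)) => // i; case: (yP i).
  rewrite [y k]surjective_pairing yk1; congr (_, _).
  have [k1|k1] := eqVneq k 1; last by case: (yP k) => _; apply.
  rewrite -ys2 (bigD1_seq k) //= big1 ?addr0 // => i ik.
  by case: (yP i) => _; apply; rewrite -k1.
Qed.

Let alpha_proj1 x : alpha (layer_proj g 1 x) = alpha x.
Proof.
elim/layer_ind: x => [|x y IHx IHy|j x xj]; first by rewrite !linear0.
  by rewrite !linearD /= IHx IHy.
by rewrite (layer_projE _ xj); case: eqP => // /eqP j1; rewrite linear0 (alpha_layer xj).
Qed.

(** If [alpha] were nonzero, [u] would act nontrivially on g_{-1} and [ext_graded] would be a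
    prolongation. By maximality it would embed in g x| R, whose degree 1 part is zero, although [u]
    is not zero. *)
Lemma degree1_eq0 : full_tanaka_is_semidirect g -> forall x, alpha x = 0.
Proof.
case=> [[p_graded_lie [[p_inj p_mor] p_neg p_0 p_der p_faith]] p_max] x; apply/eqP.
apply/contraT => ax0.
pose iota (y : g) : ext_graded := (g_to_p y, 0).
have iota_linear : linear iota
    by move=> a u v; congr pair; rewrite ?linearP //= addr0 [RHS]mulr0.
pose I : {linear g -> ext_graded} :=
  HB.pack iota (GRing.isLinear.Build R g ext_graded *:%R iota iota_linear).
have : is_prolongation I.
  split; first exact: ext_graded_lie.
  split.
  - split=> [y z /(congr1 fst) /p_inj //|y z].
    rewrite /= /iota /ext_br /= !scale0r !mul0r ?subrr addr0.
    by rewrite p_mor subr0.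
  - move=> j u j0; have jN1 : - j%:Z != 1 by lia.
    split=> [[/(p_neg _ _ j0)[y yj e] /(_ jN1) u2]|[y yj ->]].
      by exists y => //; rewrite [u]surjective_pairing u2 e.
    by split=> //=; apply/(p_neg _ _ j0); exists y.
  - move=> [u r] [/= /p_0[d dd du] /(_ isT) /= r0]; exists d => // y.
    by rewrite /= /iota /ext_br /= r0 !scale0r !mul0r !subr0 addr0 -du.
  - move=> d /p_der[u u0 du]; exists (u, 0) => // y.
    by rewrite /= /iota /ext_br /= !scale0r !mul0r !subr0 addr0 -du.
  - move=> k [u r] [/= uk rk] cu.
    have [k1|k1] := eqVneq k 1%N.
      move: uk; rewrite k1 => u0; have := cu _ (layer_proj_mem 1 x).
      (* In degree 1 the element is [r] times [u], and its bracket with the g_{-1} component of [x]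
         has real coordinate [r * alpha x]. *)
      rewrite u0 /= /iota /ext_br /= => /(congr1 (fun w => w.1.2)) /=.
      rewrite alpha_proj1 scale0r subr0 add0r => /eqP.
      by rewrite scaler_eq0 (negPf ax0) orbF => /eqP ->.
    have r0 : r = 0 by apply: rk; apply: contra k1 => /eqP [->].
    rewrite r0 (p_faith _ _ uk) // => y /cu /(congr1 fst).
    by rewrite r0 /= /iota /ext_br /= !scale0r subr0 addr0.
case/p_max => f [f_inj _ f_part _].
have : f ((0, 1) : ext_graded) = 0.
  by apply: (f_part 1); split.
rewrite -(linear0 f) => /f_inj /(congr1 snd) /= e; case/eqP: (oner_neq0 R); exact: e.
Qed.

End DegreeOne.

(** * Truncation by degree, and dilations as automorphisms *)

Section GradedMaps.
Variables (R : realType) (g : stratLie R).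
Implicit Types x y : g.
Local Notation "[ x , y ]" := (bracket x y).
Local Notation pi := (@layer_proj R g).

(** Vanishing of components is encoded as a subspace so that [br_span_subP] can propagate it to a
    whole layer. *)
Definition layers_off (P : pred nat) : {vspace g} :=
  lker (\sum_(k < (step g).+1 | P k) pi k).

Lemma layers_offP (P : pred nat) x :
  reflect (forall k, P k -> pi k x = 0) (x \in layers_off P).
Proof.
rewrite memv_ker sum_lfunE; apply: (iffP eqP) => [x0 k Pk|x0]; last first.
  by apply: big1 => k /x0.
have [ks|ks] := ltnP (step g) k; first exact: layer_proj_big.
have := congr1 (pi k) x0; rewrite linear_sum linear0.
rewrite (bigD1 (Ordinal (ks : (k < (step g).+1)%N))) //= big1 ?addr0 => [|j /andP[_ jk]].
  by rewrite layer_proj_id ?layer_proj_mem.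
by rewrite (layer_proj_other (layer_proj_mem j x)).
Qed.

Lemma layer_proj_dilation l j x : pi j (dilation g l x) = l ^+ j *: pi j x.
Proof.
elim/layer_ind: x => [|x y IHx IHy|i x xi]; first by rewrite !linear0.
  by rewrite !linearD /= IHx IHy.
rewrite (dilation_layer _ xi) linearZ /= (layer_projE _ xi).
by case: eqP => [->|]; rewrite ?scaler0.
Qed.

Lemma dilation_bracket l x y :
  dilation g l [x, y] = [dilation g l x, dilation g l y].
Proof.
apply: layer_proj_inj => m; rewrite layer_proj_dilation !layer_proj_bracket.
rewrite scaler_sumr; apply: eq_bigr => k _.
by rewrite !layer_proj_dilation !bracket_linE scalerA -exprD subnKC // -ltnS.
Qed.

Lemma dilation_degD l x : dilation g l (degD g x) = degD g (dilation g l x).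
Proof.
apply: layer_proj_inj => m.
by rewrite layer_proj_dilation !layer_proj_degD layer_proj_dilation !scalerA mulrC.
Qed.

Lemma dilationK l : l != 0 -> cancel (dilation g l) (dilation g l^-1).
Proof.
move=> l0 x; apply: layer_proj_inj => m.
by rewrite !layer_proj_dilation scalerA -exprMn mulVf // expr1n scale1r.
Qed.

(** In the product formula, [k + (m - k) < a + b] forces [k < a] or [m - k < b]. *)
Lemma bracket_tail a b x y : (forall j, (j < a)%N -> pi j x = 0) ->
  (forall j, (j < b)%N -> pi j y = 0) ->
  forall m, (m < a + b)%N -> pi m [x, y] = 0.
Proof.
move=> xa yb m mab; rewrite layer_proj_bracket big1 // => k _.
have [ka|ak] := ltnP k a; first by rewrite xa ?bracket0l.
by rewrite yb ?bracket_linE ?linear0 //; have := ltn_ord k; lia.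
Qed.

End GradedMaps.

(* In the coordinates X |-> (X, sigma X_{-1}) the bracket of s_ sigma is the
   bracket [twisted_br (dual_ext sigma)] on g. *)
Definition twisted_br (R : realType) (g : stratLie R) (a : 'Hom(g, R^o)) (x y : g) : g :=
  bracket x y + (a x : R) *: degD g y - (a y : R) *: degD g x.

(** * Morphisms between twisted brackets and their associated graded maps *)

Section TwistedMorphism.
Variables (R : realType) (g : stratLie R).
Implicit Types x y : g.
Local Notation "[ x , y ]" := (bracket x y).
Local Notation pi := (@layer_proj R g).
Local Notation D := (degD g).
Variables (sigma tau : 'Hom(g, R^o)) (F : 'End(g)).
Hypothesis F_tw : forall x y, F (twisted_br sigma x y) = twisted_br tau (F x) (F y).
Hypothesis F_layer1 : forall x, x \in layer g 1 -> F x \in layer g 1.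

Let F_bracket x y : F [x, y] = [F x, F y] + (tau (F x) : R) *: D (F y)
  - (tau (F y) : R) *: D (F x) - (sigma x : R) *: F (D y) + (sigma y : R) *: F (D x).
Proof.
have := F_tw x y; rewrite /twisted_br !lfun_linE => <-.
by vect_ring.
Qed.

(** Layer [j.+2] is spanned by brackets of layer 1 with layer [j.+1]. Bracketing with [F y] in layer
    1 shifts by exactly one, and the twisting terms do not go beyond layer [j.+1]. *)
Lemma tw_morph_filtration j x k : x \in layer g j -> (j < k)%N -> pi k (F x) = 0.
Proof.
elim: j x k => [|[|j] IH] x k xj jk.
- by move: xj; rewrite layer0 memv0 => /eqP ->; rewrite !linear0.
- by rewrite (layer_proj_other (F_layer1 xj)) // neq_ltn jk.
have [js|sj] := ltnP j.+1 (step g); last first.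
  by move: xj; rewrite layer_big // memv0 => /eqP ->; rewrite !linear0.
suff : (layer g j.+2 <= F @^-1: layers_off g (ltn j.+2))%VS.
  by move/subvP/(_ x xj); rewrite -memv_preim => /layers_offP; apply.
rewrite -(@layer_generated _ g j.+1) ?js //; apply: br_span_subP => y z y1 zj.
rewrite -memv_preim; apply/layers_offP => m /= jm.
rewrite F_bracket (degD_layer zj) (degD_layer y1) !lfun_linE !layer_proj_degD.
rewrite (IH z) ?(ltnW jm) // (layer_proj_other (F_layer1 y1)); last first.
  by rewrite neq_ltn (leq_trans _ jm).
have -> : m = (1 + m.-1)%N by rewrite add1n prednK // (leq_trans _ jm).
rewrite (layer_proj_bracketl _ _ (F_layer1 y1)) (IH z) //; last by lia.
by rewrite linear0 !scaler0 !(subr0, addr0).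
Qed.

Definition gr_map : 'End(g) := \sum_(j < (step g).+1) (pi j \o F \o pi j)%VF.

Lemma gr_map_layer j x : x \in layer g j -> gr_map x = pi j (F x).
Proof.
move=> xj; rewrite sum_lfunE; under eq_bigr do rewrite !comp_lfunE.
by rewrite (@sum_layer_proj _ _ (fun j v => pi j (F v)) _ _ _ xj) // => k; rewrite !linear0.
Qed.

(** For arguments in two layers, the twisting terms stay within the larger index, strictly below the
    sum, so they do not reach the layer of the bracket. There only the product of the two diagonal
    components survives. *)
Lemma gr_map_bracket x y : gr_map [x, y] = [gr_map x, gr_map y].
Proof.
elim/layer_ind: x => [|x x' IHx IHx'|i x xi]; first by rewrite !(linear0, bracket0l).
  by rewrite !(linearD, bracketDl) /= IHx IHx'.
elim/layer_ind: y => [|y y' IHy IHy'|j y yj]; first by rewrite !linear0.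
  by rewrite !linearD /= IHy IHy'.
rewrite (gr_map_layer xi) (gr_map_layer yj) (gr_map_layer (layer_bracket xi yj)).
rewrite F_bracket (degD_layer xi) (degD_layer yj) !lfun_linE !layer_proj_degD.
rewrite (tw_morph_filtration xi); last by lia.
rewrite (tw_morph_filtration yj); last by lia.
rewrite !scaler0 !(subr0, addr0) layer_proj_bracket.
have ij : (i.+1 < (i.+1 + j.+1).+1)%N by lia.
rewrite (bigD1 (Ordinal ij)) //= addKn big1 ?addr0 // => k kij.
have [ik|ki|ik] := ltngtP i.+1 k.
- by rewrite (tw_morph_filtration xi ik) bracket0l.
- by rewrite (tw_morph_filtration yj) ?linear0 //; lia.
- by case/eqP: kij; apply: val_inj; apply: esym ik.
Qed.

(** The image contains g_{-1} and is closed under brackets, hence is everything; injectivity follows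
    by dimension. *)
Lemma gr_map_automorphism : (layer g 1 <= F @: layer g 1)%VS ->
  graded_automorphism gr_map.
Proof.
move=> F1.
have gr_surj x : x \in limg gr_map.
  have gr1 : (layer g 1 <= limg gr_map)%VS.
    apply/subvP => z /(subvP F1) /memv_imgP[y y1 ->].
    rewrite -(layer_proj_id (F_layer1 y1)) -(gr_map_layer y1).
    exact: memv_img (memvf _).
  apply: layer1_generates x => // x y /(subvP gr1) /memv_imgP[u _ ->] /memv_imgP[v _ ->].
  by rewrite -gr_map_bracket memv_img ?memvf.
have gr_ker : lker gr_map == 0%VS.
  rewrite -dimv_eq0; have := limg_ker_dim gr_map fullv; rewrite capfv.
  have -> : limg gr_map = fullv by apply/vspaceP => x; rewrite gr_surj memvf.
  by move/eqP; rewrite -[X in _ == X]add0n eqn_add2r.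
split; last 1 first.
- move=> j; apply/vspaceP => y; apply/idP/idP.
    by case/memv_imgP => x xj ->; rewrite (gr_map_layer xj) layer_proj_mem.
  move=> yj; have /memv_imgP[x _ yE] := gr_surj y.
  (* A preimage of an element of layer [j] can be replaced by its own component in layer [j], since
     [gr_map] respects layers. *)
  rewrite yE (_ : gr_map x = gr_map (pi j x)) ?memv_img ?layer_proj_mem //.
  rewrite (gr_map_layer (layer_proj_mem j x)) -yE -{1}(layer_proj_id yj) yE.
  rewrite {1}(layer_decomp x) !linear_sum /=.
  have [js|sj] := ltnP (step g) j.
    by rewrite (layer_proj_big (F _)) // big1 // => k _; rewrite (layer_proj_big _ js).
  rewrite (bigD1 (Ordinal (sj : (j < (step g).+1)%N))) //= big1 ?addr0.
    by rewrite (gr_map_layer (layer_proj_mem j x)) layer_proj_id ?layer_proj_mem.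
  move=> k kj; rewrite (gr_map_layer (layer_proj_mem k x)).
  by rewrite (layer_proj_other (layer_proj_mem _ _) kj).
- by exists gr_map^-1%VF; [apply: lker0_lfunK | apply: lker0_lfunVK].
- exact: gr_map_bracket.
Qed.

(* The component of degree 1 of F is an element of degree 1 of the Tanaka
   prolongation, acting on g_{-1} through (tau - sigma) D. *)
Lemma unipotent_tw_morph_eq : full_tanaka_is_semidirect g ->
  (forall j x, x \in layer g j -> j != 1%N -> sigma x = 0) ->
  (forall j x, x \in layer g j -> j != 1%N -> tau x = 0) ->
  (forall j x, x \in layer g j -> pi j (F x) = x) -> sigma = tau.
Proof.
move=> hT sigma_layer tau_layer F_id.
pose h : 'End(g) := \sum_(j < (step g)) (pi j \o F \o pi j.+1)%VF.
have hE j x : x \in layer g j.+1 -> h x = pi j (F x).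
  move=> xj; rewrite sum_lfunE; under eq_bigr do rewrite !comp_lfunE.
  (* [G] shifts the index by one with a zero term at 0, turning the sum over [j < step g] into the
     form required by [sum_layer_proj]. *)
  pose G k v := if k is k'.+1 then pi k' (F v) else 0.
  rewrite -[RHS]/(G j.+1 x) -(@sum_layer_proj _ _ G _ _ _ xj) => [|[|k] /=].
  - by rewrite big_ord_recl /= add0r.
  - by [].
  - by rewrite !linear0.
suff ts x : (tau - sigma) x = 0.
  by apply/eqP; rewrite eq_sym -subr_eq0; apply/eqP/lfunP => x; rewrite ts lfunE.
apply: (@degree1_eq0 _ _ h) => // {x} [j x xj|j x xj j1|x y].
- by rewrite (hE _ _ xj) layer_proj_mem.
- by rewrite add_lfunE opp_lfunE (sigma_layer _ _ xj) // (tau_layer _ _ xj) // subr0.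
(* One index below that of [[u, v]], the twisting terms survive only for [u] in g_{-1}, where [F v]
   contributes its diagonal component [v]. *)
have key i j u v : u \in layer g i.+1 -> v \in layer g j.+1 ->
    (tau (F u) : R) *: pi (i + j.+1) (D (F v)) - (sigma u : R) *: pi (i + j.+1) (F (D v))
    = ((tau - sigma) u : R) *: D v.
  move=> ui vj; rewrite layer_proj_degD (degD_layer vj) !lfun_linE add_lfunE opp_lfunE.
  case: i ui => [|i] ui; last first.
    rewrite (tw_morph_filtration vj); last by lia.
    by rewrite (sigma_layer _ _ ui) // (tau_layer _ _ ui) // !(scaler0, scale0r, subr0).
  rewrite add0n (F_id _ _ vj).
  by rewrite -(layer_proj_id (F_layer1 ui)) (F_id _ _ ui) -scalerBl.
elim/layer_ind: x => [|x x' IHx IHx'|i x xi].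
- by rewrite !(linear0, bracket0l, scale0r, scaler0, subr0, addr0).
- by rewrite !(bracketDl, lfun_linE) IHx IHx'; vect_ring.
elim/layer_ind: y => [|y y' IHy IHy'|j y yj].
- by rewrite !(linear0, bracket0l, scale0r, scaler0, subr0, addr0).
- by rewrite !(bracketDr, lfun_linE) IHy IHy'; vect_ring.
have xy : [x, y] \in layer g (i + j.+1).+1 by rewrite -addSn layer_bracket.
rewrite (hE _ _ xy) F_bracket !lfun_linE.
have ij : (i < (i + j.+1).+1)%N by lia.
have ij1 : (i.+1 < (i + j.+1).+1)%N by lia.
(* One index below the top, a term survives only if exactly one factor has dropped by one layer:
   [k = i] or [k = i.+1]. *)
have -> : pi (i + j.+1) [F x, F y] = [h x, y] + [x, h y].
  rewrite layer_proj_bracket (bigD1 (Ordinal ij)) //= (bigD1 (Ordinal ij1)) //=; last first.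
    by rewrite -(inj_eq val_inj) /= gtn_eqF.
  rewrite addKn (F_id _ _ yj) -(hE _ _ xi) (F_id _ _ xi).
  have -> : (i + j.+1 - i.+1 = j)%N by lia.
  rewrite -(hE _ _ yj) big1 ?addr0 // => k /andP[ki ki1].
  have [ik|ki'|ik] := ltngtP k i.+1.
  - by rewrite (tw_morph_filtration yj) ?linear0 //; move: ki; rewrite -(inj_eq val_inj) /=; lia.
  - by rewrite (tw_morph_filtration xi ki') bracket0l.
  - by case/eqP: ki1; apply: val_inj.
have e1 := key _ _ _ _ xi yj; have e2 := key _ _ _ _ yj xi.
have ji : (j + i.+1 = i + j.+1)%N by lia.
rewrite ji in e2; rewrite -e1 -e2; vect_ring.
Qed.

End TwistedMorphism.

(** * Modifications in g x| R as graphs of linear forms on g_{-1} *)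

Section Modifications.
Variables (R : realType) (g : stratLie R).
Implicit Types (x y : g) (u v : semidirect g) (s : {vspace semidirect g}).
Implicit Types sigma tau : dual1 g.
Local Notation "[ x , y ]" := (bracket x y).
Local Notation pi := (@layer_proj R g).
Local Notation D := (degD g).
Local Notation br := (@semidirect_br R g).

Definition dual_ext sigma : 'Hom(g, R^o) :=
  (sigma \o (linfun (vsproj (layer g 1)) \o pi 1))%VF.

Lemma dual_extE sigma x : dual_ext sigma x = sigma (vsproj (layer g 1) (pi 1 x)).
Proof. by rewrite !comp_lfunE lfunE. Qed.

Lemma dual_ext_layer sigma j x :
  x \in layer g j -> j != 1%N -> dual_ext sigma x = 0.
Proof.
by move=> xj j1; rewrite dual_extE (layer_proj_other xj) // !linear0.
Qed.

Lemma dual_ext_proj sigma x : dual_ext sigma (pi 1 x) = dual_ext sigma x.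
Proof. by rewrite !dual_extE (layer_proj_id (layer_proj_mem 1 x)). Qed.

Lemma dual_ext_bracket sigma x y : dual_ext sigma [x, y] = 0.
Proof.
rewrite -dual_ext_proj layer_proj_bracket big1 ?linear0 // => -[[|[|//]] /= k] _.
  by rewrite layer_proj_layer0 bracket0l.
by rewrite subnn layer_proj_layer0 linear0.
Qed.

Lemma dual_ext_degD sigma x : dual_ext sigma (D x) = dual_ext sigma x.
Proof.
by rewrite -dual_ext_proj layer_proj_degD scale1r dual_ext_proj.
Qed.

Lemma dual_ext_tw sigma x y : dual_ext sigma (twisted_br (dual_ext sigma) x y) = 0.
Proof.
by rewrite /twisted_br !lfun_linE dual_ext_bracket !dual_ext_degD; linear_ring.
Qed.

Lemma dual_extZ l sigma x : dual_ext (l *: sigma) x = l * dual_ext sigma x.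
Proof. by rewrite !dual_extE scale_lfunE. Qed.

Lemma dual_ext_inj : injective dual_ext.
Proof.
move=> sigma tau e; apply/lfunP => v.
have := congr1 (fun f : 'Hom(g, R^o) => f (vsval v)) e.
by rewrite !dual_extE (layer_proj_id (subvsP v)) vsvalK.
Qed.

Lemma memv_s_ sigma u : (u \in s_ sigma) = (u.2 == dual_ext sigma u.1).
Proof.
pose f (x : g) : semidirect g := (x, sigma (vsproj (layer g 1) (pi 1 x))).
have f_lin : linear f by move=> a x y; rewrite /f !linearP.
have fE x : linfun f x = f x := linfun_linear f_lin x.
apply/memv_imgP/eqP => [[x _ ->]|u2]; first by rewrite fE /= dual_extE.
by exists u.1; rewrite ?memvf // fE /f -dual_extE -u2 -surjective_pairing.
Qed.

Lemma p_fstE u : p_fst g u = u.1.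
Proof. by rewrite linfun_linear. Qed.

Lemma p_sndE u : p_snd g u = u.2.
Proof. by rewrite linfun_linear. Qed.

Lemma memv_q_line u : (u \in q_line g) = (u.1 == 0).
Proof. by rewrite memv_ker p_fstE. Qed.

Lemma memv_g_in_p u : (u \in g_in_p g) = (u.2 == 0).
Proof. by rewrite memv_ker p_sndE. Qed.

Lemma memv_horizontal s u : (u \in horizontal s) = (u.1 \in layer g 1) && (u \in s).
Proof. by rewrite memv_cap -memv_preim p_fstE. Qed.

Lemma g_in_p_eq : g_in_p g = s_ 0.
Proof.
by apply/vspaceP => u; rewrite memv_g_in_p memv_s_ dual_extE lfunE.
Qed.

Lemma s_inj : injective (@s_ R g).
Proof.
move=> sigma tau e; apply/dual_ext_inj/lfunP => x; apply/eqP.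
by rewrite -[_ == _]/(((x, dual_ext sigma x) : semidirect g).2 == _) -memv_s_ -e memv_s_.
Qed.

Lemma semidirect_br_tw sigma x y :
  br (x, dual_ext sigma x) (y, dual_ext sigma y) = (twisted_br (dual_ext sigma) x y, 0).
Proof. by []. Qed.

Lemma s_modification sigma : modification_in_p (s_ sigma).
Proof.
split.
- move=> [x a] [y b]; rewrite !memv_s_ /= => /eqP -> /eqP ->.
  by rewrite -/(twisted_br (dual_ext sigma) x y) dual_ext_tw.
- apply/vspaceP => u; rewrite memvf; apply/memv_addP.
  exists (u.1, dual_ext sigma u.1); first by rewrite memv_s_.
  exists (0, u.2 - dual_ext sigma u.1); first by rewrite memv_q_line.
  by rewrite [u in LHS]surjective_pairing; congr (_, _); rewrite /= ?addr0 // addrC subrK.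
- apply/vspaceP => u; rewrite memv_cap memv_s_ memv_q_line memv0.
  apply/andP/eqP => [[/eqP u2 /eqP u1]|->]; last by rewrite !linear0; split.
  by rewrite [u]surjective_pairing u2 u1 linear0.
Qed.

(** The form is the real coordinate of the projection of [(x, 0)] onto [s] along q; that projection
    leaves the g coordinate unchanged. *)
Lemma complement_graph s : (s + q_line g = fullv)%VS -> (s :&: q_line g = 0)%VS ->
  exists a : 'Hom(g, R^o), forall u, (u \in s) = (u.2 == a u.1).
Proof.
move=> s_full s_cap.
pose inl (x : g) : semidirect g := (x, 0).
have inl_lin : linear inl by move=> a x y; congr pair; rewrite /= addr0 [RHS]mulr0.
have IE x : linfun inl x = inl x := linfun_linear inl_lin x.
pose a : 'Hom(g, R^o) := (p_snd g \o (daddv_pi s (q_line g) \o linfun inl))%VF.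
have sE x : (x, a x) \in s.
  have e := daddv_pi_add s_cap (_ : inl x \in (s + q_line g)%VS).
  rewrite s_full memvf in e; have {}e := e isT.
  have w1 : (daddv_pi s (q_line g) (inl x)).1 = x.
    have /eqP q1 : (daddv_pi (q_line g) s (inl x)).1 == 0 by rewrite -memv_q_line memv_pi.
    by have := congr1 fst e; rewrite /= q1 addr0.
  rewrite /a !comp_lfunE IE p_sndE -[X in (X, _)]w1 -surjective_pairing; exact: memv_pi.
exists a => u; apply/idP/eqP => [us|u2]; last by rewrite [u]surjective_pairing u2.
have : u - (u.1, a u.1) \in (s :&: q_line g)%VS.
  by rewrite memv_cap memvB // memv_q_line /= subrr.
by rewrite s_cap memv0 => /eqP /(congr1 snd) /= /eqP; rewrite subr_eq0 => /eqP.
Qed.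

(** Closure under the bracket says that [a] kills the twisted brackets. For [x] in layer 1 and [y]
    in layer [k.+1] this reads [a [x, y] = - k * a x * a y], which is zero for [k = 0] and, by
    induction through [a y = 0], for [k > 0]. *)
Lemma modificationP s : modification_in_p s -> exists sigma, s = s_ sigma.
Proof.
case=> s_br s_full s_cap; have [a sP] := complement_graph s_full s_cap.
have sE x : (x, a x) \in s by rewrite sP.
have a_tw x y : a (twisted_br a x y) = 0.
  by have := s_br _ _ (sE x) (sE y); rewrite sP => /eqP /= <-.
have a_layer j x : x \in layer g j -> j != 1%N -> a x = 0.
  case: j => [|[//|j]] xj _; first by move: xj; rewrite layer0 memv0 => /eqP ->; rewrite linear0.
  suff {x xj} : (layer g j.+2 <= lker a)%VS by move/subvP/(_ x xj); rewrite memv_ker => /eqP.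
  have a_next k : (forall x y, x \in layer g 1 -> y \in layer g k.+1 -> a [x, y] = 0) ->
      (layer g k.+2 <= lker a)%VS.
    move=> ak; have [ks|ks] := ltnP k.+1 (step g); last by rewrite layer_big ?sub0v.
    rewrite -(@layer_generated _ g k.+1) ?ks //; apply: br_span_subP => x y x1 yk.
    by rewrite memv_ker ak.
  elim: j => [|j IH]; apply: a_next => x y x1 yj; rewrite -(a_tw x y) /twisted_br !lfun_linE;
    rewrite (degD_layer x1) (degD_layer yj) !lfun_linE; first by linear_ring.
  have -> : a y = 0 by apply/eqP; rewrite -memv_ker; apply: subvP IH _ yj.
  by linear_ring.
pose sigma : dual1 g := (a \o linfun vsval)%VF.
exists sigma; apply/vspaceP => u; rewrite sP memv_s_; congr (_ == _).
rewrite dual_extE comp_lfunE lfunE /= vsprojK ?layer_proj_mem //.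
elim/layer_ind: u.1 => [|x y IHx IHy|j x xj]; first by rewrite !linear0.
  by rewrite !linearD /= IHx IHy.
rewrite (layer_projE _ xj); case: eqP => // /eqP j1.
by rewrite (a_layer _ _ xj) // linear0.
Qed.

Lemma s_bracket_generating sigma :
  bracket_generating br (s_ sigma) (horizontal (s_ sigma)).
Proof.
split=> [|W W_br /subvP hW]; first exact: capvSr.
have W1 x : x \in layer g 1 -> (x, dual_ext sigma x) \in W.
  by move=> x1; apply: hW; rewrite memv_horizontal memv_s_ x1 /=.
suff WE x : (x, dual_ext sigma x) \in W.
  by apply/subvP => u; rewrite memv_s_ [u]surjective_pairing => /eqP /= ->.
elim/layer_ind: x => [|x y IHx IHy|j x xj]; first by rewrite linear0 mem0v.
  by rewrite linearD; apply: memvD IHx IHy.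
pose inl (x : g) : semidirect g := (x, dual_ext sigma x).
have inl_lin : linear inl by move=> a x' y; rewrite /inl linearP.
have IE x' : linfun inl x' = inl x' := linfun_linear inl_lin x'.
suff {x xj} : (layer g j.+1 <= linfun inl @^-1: W)%VS.
  by move/subvP/(_ x xj); rewrite -memv_preim IE.
elim: j => [|j IH]; first by apply/subvP => x x1; rewrite -memv_preim IE W1.
have [js|sj] := ltnP j.+1 (step g); last by rewrite layer_big ?sub0v.
rewrite -(@layer_generated _ g j.+1) ?js //; apply: br_span_subP => x y x1 yj.
have := subvP IH y yj; rewrite -!memv_preim !IE => Wy.
have := W_br _ _ (W1 x x1) Wy; rewrite semidirect_br_tw => Wxy.
(* The twisting terms are multiples of [x] and [y], so [inl [x, y]] is recovered inside [W]. The
   real coordinates cancel when [y] is in layer 1; in deeper layers the form vanishes at [y]. *)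
have -> : inl [x, y] = (twisted_br (dual_ext sigma) x y, 0 : R^o) -
    ((dual_ext sigma x * j.+1%:R : R) *: inl y - (dual_ext sigma y : R) *: inl x).
  rewrite /twisted_br (degD_layer x1) (degD_layer yj); congr pair => /=.
    by vect_ring.
  rewrite dual_ext_bracket.
  case: j yj {js IH} => [|j] yj; first by linear_ring.
  by rewrite (dual_ext_layer _ yj) //; linear_ring.
by rewrite memvB // memvB // memvZ // W1.
Qed.

Lemma pair_iso_refl (P : lie_pair R) : pair_iso P P.
Proof.
exists \1%VF; split=> [|x y _ _|x y _ _|]; rewrite ?lim1g ?id_lfunE //.
Qed.

Lemma s_is_modification sigma : is_lie br -> is_modification g (pair_in_p (s_ sigma)).
Proof.
move=> br_lie; have sm := s_modification sigma; split.
  by split=> //=; [case: sm | apply: s_bracket_generating].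
by exists (s_ sigma) => //; apply: pair_iso_refl.
Qed.

(** * Solvability and nilpotency through the filtration by degree *)

Definition low_degree m : {vspace semidirect g} :=
  ((p_fst g @^-1: layers_off g (gtn m)) :&: g_in_p g)%VS.

Lemma low_degreeP m u :
  u \in low_degree m <-> (forall k, (k < m)%N -> pi k u.1 = 0) /\ u.2 = 0.
Proof.
rewrite memv_cap -memv_preim p_fstE memv_g_in_p; split.
  by case/andP => /layers_offP u1 /eqP.
by case=> u1 ->; rewrite eqxx andbT; apply/layers_offP.
Qed.

Lemma low_degree_br a b u v : u \in low_degree a -> v \in low_degree b ->
  br u v \in low_degree (a + b).
Proof.
move=> /low_degreeP[u1 u2] /low_degreeP[v1 v2]; apply/low_degreeP; split=> //.
rewrite /semidirect_br u2 v2 /= !scale0r subr0 addr0.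
exact: bracket_tail.
Qed.

Lemma low_degree_le a b : (a <= b)%N -> (low_degree b <= low_degree a)%VS.
Proof.
move=> ab; apply/subvP => u /low_degreeP[u1 u2]; apply/low_degreeP; split=> // k ka.
by apply: u1; apply: leq_trans ab.
Qed.

Lemma low_degree0 : low_degree (step g).+1 = 0%VS.
Proof.
apply/eqP; rewrite -subv0; apply/subvP => u /low_degreeP[u1 u2].
rewrite memv0 [u]surjective_pairing u2 xpair_eqE eqxx andbT; apply/eqP.
rewrite -[RHS](linear0 (pi 0)); apply: layer_proj_inj => j.
have [js|sj] := ltnP (step g) j; first by rewrite !(layer_proj_big _ js).
by rewrite u1 // linear0 linear0.
Qed.

Lemma br_low_degree1 u v : br u v \in low_degree 1.
Proof.
apply/low_degreeP; split=> // k; rewrite ltnS leqn0 => /eqP ->.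
exact: layer_proj_layer0.
Qed.

(** Every bracket has real coordinate 0, so it lies in [low_degree 1]; from there each derived step
    moves at least one layer deeper, until the layers are exhausted. *)
Lemma semidirect_solvable s : solvable_alg br s.
Proof.
exists (step g).+1; apply/eqP; rewrite -subv0 -low_degree0.
elim: (step g) => [|n IH].
  by apply: br_span_subP => u v _ _; apply: br_low_degree1.
rewrite iterS; apply: br_span_subP => u v /(subvP IH) un /(subvP IH) vn.
by apply: subvP (low_degree_br un vn); apply: low_degree_le; rewrite addSn ltnS leq_addl.
Qed.

Lemma g_in_p_low_degree1 : (g_in_p g <= low_degree 1)%VS.
Proof.
apply/subvP => u; rewrite memv_g_in_p => /eqP u2; apply/low_degreeP; split=> // k.
by rewrite ltnS leqn0 => /eqP ->; exact: layer_proj_layer0.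
Qed.

Lemma g_in_p_nilpotent : nilpotent_alg br (g_in_p g).
Proof.
(* The iterate of order 0 already lies in [low_degree 1], so [step g] brackets suffice to reach
   [low_degree (step g).+1]. *)
exists (step g); apply/eqP; rewrite -subv0 -low_degree0.
elim: (step g) => [|n IH]; first exact: g_in_p_low_degree1.
rewrite iterS; apply: br_span_subP => u v /(subvP g_in_p_low_degree1) u1 /(subvP IH) vn.
by rewrite -[n.+2]add1n; apply: low_degree_br.
Qed.

(* ad (x, sigma x) acts on the g_{-1} component of ker sigma as sigma x. *)
Lemma s_nilpotent_layer1 sigma x y : is_lie br -> nilpotent_alg br (s_ sigma) ->
  x \in layer g 1 -> y \in layer g 1 ->
  (dual_ext sigma x : R) *: y = (dual_ext sigma y : R) *: x.
Proof.
move=> br_lie [n nil] x1 y1.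
wlog sx0 : x y x1 y1 / dual_ext sigma x != 0 => [hw|].
  have [sx|sx] := eqVneq (dual_ext sigma x) 0; last exact: hw.
  have [sy|sy] := eqVneq (dual_ext sigma y) 0; last exact/esym/hw.
  by rewrite sx sy !scale0r.
(* The claim is [z = 0]. As [z] lies in ker sigma, iterating ad [(x, sigma x)] on [(z, 0)]
   multiplies its g_{-1} component by the nonzero scalar sigma x each time, while nilpotency makes
   some iterate zero. *)
pose z := (dual_ext sigma x : R) *: y - (dual_ext sigma y : R) *: x.
have z1 : z \in layer g 1 by rewrite memvB ?memvZ.
have sz : dual_ext sigma z = 0 by rewrite /z !lfun_linE; linear_ring.
have [w [wn w2 wz]] : exists w : semidirect g,
    [/\ w \in iter n (br_span br (s_ sigma)) (s_ sigma), w.2 = 0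
      & pi 1 w.1 = (dual_ext sigma x ^+ n : R) *: z].
  elim: n {nil} => [|n [w [wn w2 wz]]].
    exists (z, 0); rewrite memv_s_ /= sz eqxx; split=> //.
    by rewrite layer_proj_id // scale1r.
  exists (br (x, dual_ext sigma x) w); split=> //.
    by rewrite iterS; apply: memv_br_span => //; rewrite memv_s_.
  rewrite /= w2 scale0r subr0 linearD linearZ /= layer_proj_degD wz.
  rewrite -[X in pi X _]addn0 (layer_proj_bracketl _ _ x1) layer_proj_layer0 linear0.
  by rewrite add0r scale1r scalerA exprS.
move: wn; rewrite nil memv0 => /eqP w0; move: wz; rewrite w0 /= linear0 => /esym /eqP.
by rewrite scaler_eq0 expf_eq0 (negPf sx0) andbF /= subr_eq0 => /eqP.
Qed.

(** If sigma is nonzero, the preceding relation makes g_{-1} a line, so its brackets vanish and g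
    equals g_{-1}. Then [h = 0] and [alpha = sigma] define an element of degree 1, which
    [degree1_eq0] excludes. *)
Lemma s_nilpotent_eq0 sigma : full_tanaka_is_semidirect g ->
  nilpotent_alg br (s_ sigma) -> sigma = 0.
Proof.
move=> hT nil; have br_lie : is_lie br by case: hT => [[[]]].
have prop x y := @s_nilpotent_layer1 sigma x y br_lie nil.
apply/dual_ext_inj/lfunP => x.
have -> : dual_ext (0 : dual1 g) x = 0 by rewrite dual_extE lfunE.
apply/eqP/contraT => sx0; suff /eqP : dual_ext sigma x = 0 by rewrite (negPf sx0).
have br0 y z : y \in layer g 1 -> z \in layer g 1 -> [y, z] = 0.
  move=> y1 z1; have x1 := layer_proj_mem 1 x.
  rewrite -dual_ext_proj in sx0.
  have yE := prop _ _ x1 y1; have zE := prop _ _ x1 z1.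
  apply: (scalerI sx0); apply: (scalerI sx0).
  by rewrite -bracketZl -bracketZr yE zE !bracket_linE bracketxx !scaler0.
have all1 y : y \in layer g 1.
  by apply: layer1_generates y => // y z y1 z1; rewrite br0 // mem0v.
apply: (@degree1_eq0 _ _ 0) => // [j y _|j y yj j1|y z].
- by rewrite lfunE mem0v.
- exact: dual_ext_layer yj j1.
rewrite !zero_lfunE bracket0l linear0 !(degD_layer (all1 _)) !scale1r.
by rewrite (prop _ _ (all1 y) (all1 z)) add0r add0r subrr.
Qed.

(** * Isomorphisms between modifications *)

Lemma dual_ext_dilation sigma l x : dual_ext sigma (dilation g l x) = l * dual_ext sigma x.
Proof.
by rewrite -dual_ext_proj layer_proj_dilation expr1 linearZ /= dual_ext_proj.
Qed.

(** A dilation times the identity of R is an automorphism of g x| R, as dilations commute with D; it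
    scales g_{-1} by [l], which turns the graph of [l *: tau] into that of [tau]. *)
Lemma dilation_s_iso l tau : l != 0 ->
  pair_iso (pair_in_p (s_ (l *: tau))) (pair_in_p (s_ tau)).
Proof.
move=> l0; pose f u : semidirect g := (dilation g l u.1, u.2).
have f_lin : linear f by move=> a u v; congr pair; rewrite /= linearP.
have fE u : linfun f u = f u := linfun_linear f_lin u.
have fs u : (f u \in s_ tau) = (u \in s_ (l *: tau)).
  by rewrite !memv_s_ dual_ext_dilation dual_extZ.
have fK k u : k != 0 -> ((dilation g k (dilation g k^-1 u.1), u.2) : semidirect g) = u.
  move=> k0; rewrite -{1}[k]invrK dilationK ?invr_eq0 //.
  by case: u.
have f1 u : ((f u).1 \in layer g 1) = (u.1 \in layer g 1).
  have dil1 k x : x \in layer g 1 -> dilation g k x \in layer g 1.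
    by move=> x1; rewrite (dilation_layer _ x1) memvZ.
  by apply/idP/idP => [/(dil1 l^-1)|/(dil1 l) //]; rewrite dilationK.
have img (U V : {vspace semidirect g}) : (forall u, (f u \in V) = (u \in U)) ->
    (linfun f @: U = V)%VS.
  move=> fUV; apply/vspaceP => u; apply/memv_imgP/idP => [[v vU ->]|uV].
    by rewrite fE fUV.
  exists (dilation g l^-1 u.1, u.2); last by rewrite fE /f fK.
  by rewrite -fUV /f fK.
exists (linfun f); split=> /=.
- exact: img.
- move=> u v _ _; rewrite !fE => -[e1 e2].
  rewrite [u]surjective_pairing [v]surjective_pairing e2.
  by rewrite -(dilationK l0 u.1) e1 dilationK.
- move=> u v _ _; rewrite !fE; congr pair => /=.
  by rewrite !lfun_linE dilation_bracket !dilation_degD.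
- by apply: img => u; rewrite !memv_horizontal f1 fs.
Qed.

(** Read in graph coordinates, the isomorphism becomes an endomorphism [F] of g intertwining the two
    twisted brackets and mapping g_{-1} onto itself, so its associated graded map falls under
    ultra-rigidity. *)
Lemma s_iso_dilation (ratio : R -> Prop) sigma tau :
  full_tanaka_is_semidirect g -> (forall l, ratio l -> l != 0) ->
  ultra_rigid g ratio -> pair_iso (pair_in_p (s_ sigma)) (pair_in_p (s_ tau)) ->
  exists2 l, ratio l & sigma = l *: tau.
Proof.
move=> hT ratio0 rigid [f [/= f_s _ f_br f_hor]].
pose inl x : semidirect g := (x, dual_ext sigma x).
have inl_lin : linear inl by move=> a x y; rewrite /inl linearP.
have IE x : linfun inl x = inl x := linfun_linear inl_lin x.
pose F : 'End(g) := (p_fst g \o (f \o linfun inl))%VF.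
have FE x : F x = (f (inl x)).1 by rewrite /F !comp_lfunE IE p_fstE.
clearbody F.
have inl_s x : inl x \in s_ sigma by rewrite memv_s_.
have fE x : f (inl x) = (F x, dual_ext tau (F x)).
  have : f (inl x) \in s_ tau by rewrite -f_s memv_img.
  by rewrite memv_s_ -FE [f _]surjective_pairing -FE => /eqP /= ->.
have F_tw x y : F (twisted_br (dual_ext sigma) x y) = twisted_br (dual_ext tau) (F x) (F y).
  rewrite FE /inl dual_ext_tw -semidirect_br_tw f_br ?inl_s //.
  by rewrite -/(inl x) -/(inl y) !fE.
have F1 x : x \in layer g 1 -> F x \in layer g 1.
  move=> x1; have : f (inl x) \in horizontal (s_ tau).
    by rewrite -f_hor memv_img // memv_horizontal x1 inl_s.
  by rewrite memv_horizontal fE => /andP[].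
have F1_surj : (layer g 1 <= F @: layer g 1)%VS.
  apply/subvP => y y1.
  have : (y, dual_ext tau y) \in horizontal (s_ tau) by rewrite memv_horizontal memv_s_ y1 /=.
  rewrite -f_hor => /memv_imgP[u]; rewrite memv_horizontal memv_s_ => /andP[u1 /eqP u2] e.
  apply/memv_imgP; exists u.1 => //.
  by rewrite FE /inl -u2 -surjective_pairing -e.
have [l rl Fl] := rigid _ (gr_map_automorphism F_tw F1 F1_surj).
have l0 := ratio0 l rl; exists l => //; apply: dual_ext_inj.
(* Undoing the dilation makes every diagonal component the identity. The target form becomes
   [l *: tau], because tau takes at [F x] the value of [l *: tau] at the rescaled vector. *)
apply: (@unipotent_tw_morph_eq _ _ _ _ (dilation g l^-1 \o F)%VF) => //.
- move=> x y; rewrite !comp_lfunE F_tw /twisted_br !lfun_linE !dual_extZ !dual_ext_dilation.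
  by rewrite dilation_bracket !dilation_degD !mulrA mulfV // !mul1r.
- by move=> x x1; rewrite comp_lfunE (dilation_layer _ (F1 _ x1)) memvZ ?F1.
- by move=> j x; apply: dual_ext_layer.
- by move=> j x; apply: dual_ext_layer.
move=> j x xj; rewrite comp_lfunE layer_proj_dilation -(gr_map_layer F xj) Fl.
by rewrite (dilation_layer _ xj) scalerA -exprMn mulVf // expr1n scale1r.
Qed.

(** Keeping [ratio] general, with nonzero factors, treats positive and arbitrary nonzero dilation
    factors at once. *)
Lemma modifications_parametrised (ratio : R -> Prop) :
  full_tanaka_is_semidirect g -> (forall l, ratio l -> l != 0) ->
  ultra_rigid g ratio -> parametrised_by_dual1_mod g ratio.
Proof.
move=> hT ratio0 rigid; have br_lie : is_lie br by case: hT => [[[]]].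
split.
- move=> s; split=> [/modificationP[sigma sE]|[sigma [-> _]]]; last exact: s_modification.
  by exists sigma; split=> // tau; rewrite sE => /s_inj.
- by move=> sigma; apply: s_is_modification.
- by move=> P [_ [s /modificationP[sigma ->] iso]]; exists sigma.
- move=> sigma tau; split; first exact: s_iso_dilation.
  by case=> l /ratio0 l0 ->; apply: dilation_s_iso.
Qed.

End Modifications.

Theorem theorem5p9 (R : realType) (g : stratLie R)
    (hT : full_tanaka_is_semidirect g) :
  [/\ ultra_rigid g (fun l => 0 < l) ->
        parametrised_by_dual1_mod g (fun l => 0 < l),
      ultra_rigid g (fun l => l != 0) ->
        parametrised_by_dual1_mod g (fun l => l != 0),
      forall s, modification_in_p s -> solvable_alg (@semidirect_br R g) s
    & forall s, modification_in_p s /\ nilpotent_alg (@semidirect_br R g) s <->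
        s = g_in_p g].
Proof.
split.
- by apply: modifications_parametrised => // l; apply: lt0r_neq0.
- exact: modifications_parametrised.
- by move=> s _; apply: semidirect_solvable.
move=> s; split=> [[/modificationP[sigma ->] nil]|->].
  by rewrite g_in_p_eq (s_nilpotent_eq0 hT nil).
split; last exact: g_in_p_nilpotent.
by rewrite g_in_p_eq; apply: s_modification.
Qed.
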